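(* Let $n,p\ge 1$ be integers, let $M$ be a constant, and let $X_1,\ldots,X_p$ be (possibly dependent) real random variables with $|X_j|\le M$ almost surely for each $j$. Let $\beta_1^*,\ldots,\beta_p^*\in\mathbb{R}$ and $\sigma\ge 0$ be constants, and let $$Y=\sum_{j=1}^p\beta_j^*X_j+\varepsilon,$$ where $\varepsilon\sim N(0,\sigma^2)$ is independent of $(X_1,\ldots,X_p)$. Let $\mathbf{Z}=(Y,X_1,\ldots,X_p)$ and let $\mathbf{Z}_i=(Y_i,X_{i,1},\ldots,X_{i,p})$, $i=1,\ldots,n$, be i.i.d. copies of $\mathbf{Z}$, independent of $\mathbf{Z}$. Let $K>0$ be any constant such that $$\sum_{j=1}^p|\beta_j^*|\le K,$$ and let $\tilde{\boldsymbol\beta}^K=(\tilde\beta_1^K,\ldots,\tilde\beta_p^K)$ be the Lasso estimator with constraint level $K$ computed from $\mathbf{Z}_1,\ldots,\mathbf{Z}_n$ (as defined in the context). Then the mean squared prediction error satisfies $$\mathrm{MSPE}(\tilde{\boldsymbol\beta}^K)\le 2KM\sigma\sqrt{\frac{2\log(2p)}{n}}+8K^2M^2\sqrt{\frac{2\log(2p^2)}{n}}.$$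
   Context: Lasso estimator: for $K>0$, $\tilde{\boldsymbol\beta}^K=(\tilde\beta_1^K,\ldots,\tilde\beta_p^K)$ is a minimizer of $$\sum_{i=1}^n\bigl(Y_i-\beta_1X_{i,1}-\cdots-\beta_pX_{i,p}\bigr)^2$$ over all $(\beta_1,\ldots,\beta_p)\in\mathbb{R}^p$ subject to the constraint $\sum_{j=1}^p|\beta_j|\le K$. If there are multiple minimizers, one is chosen according to some predefined (measurable) rule, so that $\tilde{\boldsymbol\beta}^K$ is a function of the data $\mathbf{Z}_1,\ldots,\mathbf{Z}_n$. Mean squared prediction error: for an estimator $\tilde{\boldsymbol\beta}=(\tilde\beta_1,\ldots,\tilde\beta_p)$ computed from the data $\mathbf{Z}_1,\ldots,\mathbf{Z}_n$ (hence independent of $X_1,\ldots,X_p$), $$\mathrm{MSPE}(\tilde{\boldsymbol\beta}):=\mathbb{E}(\hat Y-\tilde Y)^2,\qquad \hat Y:=\sum_{j=1}^p\beta_j^*X_j,\qquad \tilde Y:=\sum_{j=1}^p\tilde\beta_jX_j.$$ *)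

(* Defs.v *)
From HB Require Import structures.
From mathcomp Require Export all_boot all_order all_algebra.
From mathcomp Require Export all_classical all_reals all_analysis.
Export Order.TTheory GRing.Theory Num.Theory.
Export numFieldNormedType.Exports.

Set Implicit Arguments.
Unset Strict Implicit.
Unset Printing Implicit Defensive.

Local Open Scope classical_set_scope.
Local Open Scope ring_scope.

Section Probability.
Context {d : measure_display} {T : measurableType d} {R : realType}.
Variable P : probability T R.

(* Equality is only required on measurable sets: [distribution] is also total
   on non-measurable ones, where its value is irrelevant. *)
Definition has_law {d'} {T' : measurableType d'} (U : {RV P >-> T'})
    (mu : set T' -> \bar R) : Prop :=
  forall A : set T', measurable A -> distribution P U A = mu A.

Definition identically_distributed {d'} {T' : measurableType d'}
    (U V : {RV P >-> T'}) : Prop :=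
  has_law U (distribution P V).

Definition independent2 {d1 d2} {T1 : measurableType d1}
    {T2 : measurableType d2} (U : T -> T1) (V : T -> T2) : Prop :=
  forall (A : set T1) (B : set T2), measurable A -> measurable B ->
    P (U @^-1` A `&` V @^-1` B) = (P (U @^-1` A) * P (V @^-1` B))%E.

(* The product rule for subfamilies is the case where the other [A i] are
   [setT]. *)
Definition mutually_independent {I : finType} {d'} {T' : measurableType d'}
    (U : I -> T -> T') : Prop :=
  forall A : I -> set T', (forall i, measurable (A i)) ->
    P (\bigcap_i (U i @^-1` A i)) = (\prod_i P (U i @^-1` A i))%E.

End Probability.

(* The centred Gaussian law with standard deviation [s]; the point mass at 0
   when [s = 0], a case where [normal_prob] is the uniform law on [0, 1]. *)
Definition gaussian_law {R : realType} (s : R) : set R -> \bar R :=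
  if s == 0 then \d_(0 : R) else normal_prob 0 s.

Section Lasso.
Context {R : realType} {p : nat}.

Definition dotp (b x : p.-tuple R) : R := \sum_(j < p) tnth b j * tnth x j.

Definition norm1 (b : p.-tuple R) : R := \sum_(j < p) `|tnth b j|.

Definition rss {n} (z : n.-tuple (R * p.-tuple R)) (b : p.-tuple R) : R :=
  \sum_(i < n) ((tnth z i).1 - dotp b (tnth z i).2) ^+ 2.

Definition lasso_minimizer {n} (K : R) (z : n.-tuple (R * p.-tuple R))
    (b : p.-tuple R) : Prop :=
  norm1 b <= K /\ forall b', norm1 b' <= K -> rss z b <= rss z b'.

(* Minimizers need not be unique: a Lasso estimator is any measurable map
   sending every data set to one of its minimizers. *)
Definition lasso_estimator {n} (K : R)
    (f : n.-tuple (R * p.-tuple R) -> p.-tuple R) : Prop :=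
  measurable_fun setT f /\ forall z, lasso_minimizer K z (f z).

Definition MSPE {d} {T : measurableType d} (P : probability T R)
    (X : T -> p.-tuple R) (betastar : p.-tuple R) (betahat : T -> p.-tuple R) :
    \bar R :=
  'E_P[fun w => ((dotp betastar (X w) - dotp (betahat w) (X w)) ^+ 2)%R]%E.

End Lasso.

(* Main.v *)
From HB Require Import structures.
Require Import Defs.
From mathcomp Require Import measurable_realfun ring lra.

(** Write [x_i], [y_i] for the observed covariates and responses, [e_i] for the
    noise [y_i - beta . x_i], where [beta] is the true coefficient vector, and
    [dl] for the estimation error [beta - b] of the Lasso fit [b]; both [beta]
    and [b] lie in the l1-ball of radius [K], so [dl] has l1-norm at most [2K].

    The new covariate vector is independent of the data, so given the data the
    prediction error is the quadratic form of [dl] in the second moments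
    [m j k = E X_j X_k] ([independent2_decouple], [integral_dotp_sqr]).
    Comparing [m] with the empirical second moments splits this form in two
    ([lasso_error_bound]):

    - the in-sample error [n^-1 sum_i (dl . x_i)^2].  The fitted vector is the
      projection of the responses on a convex set that contains the true
      regression vector, so the in-sample error is at most
      [n^-1 sum_i e_i (b - beta) . x_i] ([lasso_basic_inequality]), hence at
      most [2K/n] times [max_j |U_j|] with [U_j = sum_i e_i x_ij];

    - the discrepancy [sum_jk dl_j dl_k V_jk], at most [4K^2 max_jk |V_jk|],
      where [V_jk = m j k - n^-1 sum_i x_ij x_ik].

    Both maxima no longer involve the estimator, and range over sums of [n]
    i.i.d. terms whose moment generating functions are subgaussian: a bounded
    multiple of an independent Gaussian for [U_j] ([gaussian_mul_bounded_mgf]),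
    a centred bounded variable for [V_jk] ([bounded_deviation_mgf]).
    Independence multiplies the generating functions ([iid_sum_mgf]), and the
    maximal inequality [E max_a |W_a| <= s sqrt (2 ln (2N))] for [N] subgaussian
    variables ([expectation_max_subgaussian]) gives the two terms of the bound,
    with [s = sqrt n * sigma * M] for the [U_j] and [s = 2 M^2 / sqrt n] for the
    [V_jk]. *)

Set Implicit Arguments.
Unset Strict Implicit.
Unset Printing Implicit Defensive.

Local Open Scope classical_set_scope.
Local Open Scope ring_scope.

(** * Integrals of functions of independent variables *)

Section weighted.
Local Open Scope ereal_scope.
Import HBNNSimple.

Lemma integral_weighted_nnsfun (R : realType) d d' (T : measurableType d)
    (T' : measurableType d') (mu : {measure set T -> \bar R}) (V : T -> T')
    (h : T -> \bar R) (g : {nnsfun T' >-> R}) :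
  measurable_fun setT V -> measurable_fun setT h -> (forall x, 0 <= h x) ->
  \int[mu]_x (h x * (g (V x))%:E) =
  \sum_(y \in range g) y%:E * \int[mu]_x (h x * (\1_(g @^-1` [set y]) (V x))%:E).
Proof.
move=> mV mh h0.
have m1 y : measurable_fun setT (fun x => (\1_(g @^-1` [set y]) (V x))%:E : \bar R).
  apply/measurable_EFinP; apply: measurableT_comp => //.
have mterm y : measurable_fun setT
    (fun x => h x * (\1_(g @^-1` [set y]) (V x))%:E).
  exact: emeasurable_funM.
transitivity (\int[mu]_x (\sum_(y \in range g)
    (y%:E * (h x * (\1_(g @^-1` [set y]) (V x))%:E)))).
  apply: eq_integral => x _.
  rewrite (fimfunE g (V x)) -fsumEFin//.
  rewrite ge0_mule_fsumr//; last first.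
    move=> y; rewrite lee_fin.
    have [y0|y0] := leP 0%R y; first by rewrite mulr_ge0.
    rewrite indicE memNset ?mulr0//= => gy.
    by move: y0; rewrite -gy ltNge fun_ge0.
  apply: eq_fsbigr => y _.
  by rewrite EFinM muleCA.
rewrite ge0_integral_fsum//; last 2 first.
  - by move=> y; exact: measurable_funeM.
  - move=> y x _.
    have [y0|y0] := leP 0%R y.
      by rewrite mule_ge0// mule_ge0// lee_fin.
    rewrite indicE memNset ?mule0//= => gy.
    by move: y0; rewrite -gy ltNge fun_ge0.
apply: eq_fsbigr => y /set_mem [t _ <-].
rewrite ge0_integralZl// ?lee_fin//.
by move=> x _; rewrite mule_ge0// lee_fin.
Qed.

(** Two image measures with densities that agree on measurable sets give the same
    integrals.  Allowing a weight on each side covers both the removal of one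
    independent factor from a product (one weight is the product of the other
    factors, the other a constant) and the passage from a law to its Lebesgue
    density. *)
Lemma eq_ge0_integral_weighted (R : realType) d1 d2 d' (T1 : measurableType d1)
    (T2 : measurableType d2) (T' : measurableType d')
    (mu : {measure set T1 -> \bar R}) (nu : {measure set T2 -> \bar R})
    (V : T1 -> T') (W : T2 -> T') (h : T1 -> \bar R) (k : T2 -> \bar R)
    (f : T' -> \bar R) :
  measurable_fun setT V -> measurable_fun setT W ->
  measurable_fun setT h -> measurable_fun setT k ->
  (forall x, 0 <= h x) -> (forall x, 0 <= k x) ->
  (forall A, measurable A ->
    \int[mu]_x (h x * (\1_A (V x))%:E) = \int[nu]_x (k x * (\1_A (W x))%:E)) ->
  measurable_fun setT f -> (forall y, 0 <= f y) ->
  \int[mu]_x (h x * f (V x)) = \int[nu]_x (k x * f (W x)).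
Proof.
move=> mV mW mh mk h0 k0 hk mf f0.
pose g := nnsfun_approx measurableT mf.
have lim_g d (T : measurableType d) (m : {measure set T -> \bar R}) (U : T -> T')
    (w : T -> \bar R) : measurable_fun setT U -> measurable_fun setT w ->
    (forall x, 0 <= w x) ->
    \int[m]_x (w x * f (U x)) = limn (fun n => \int[m]_x (w x * (g n (U x))%:E)).
  move=> mU mw w0; rewrite -monotone_convergence//.
  - apply: eq_integral => x _; apply/esym/cvg_lim => //.
    have gf : (g n (U x))%:E @[n --> \oo] --> f (U x).
      exact: cvg_nnsfun_approx.
    have := w0 x; rewrite le_eqVlt => /predU1P[<-|wx0].
      by under eq_fun do rewrite mul0e; rewrite mul0e; exact: cvg_cst.
    have := f0 (U x); rewrite le_eqVlt => /predU1P[fx0|fx0]; last first.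
      by apply: cvgeM => //; [apply: neq0_mule_def; rewrite gt_eqF ?mule_gt0|exact: cvg_cst].
    rewrite -fx0 mule0.
    rewrite (_ : (fun n => _) = cst 0); first exact: cvg_cst.
    apply/funext => n; rewrite /cst.
    suff -> : g n (U x) = 0%R by rewrite mule0.
    apply/eqP; rewrite eq_le fun_ge0 andbT -lee_fin [leRHS]fx0.
    by rewrite /g nnsfun_approxE; exact: le_approx.
  - move=> n; apply: emeasurable_funM => //.
    by apply/measurable_EFinP; exact: measurableT_comp.
  - by move=> n x _; rewrite mule_ge0// lee_fin.
  - move=> x _ a b ab; apply: lee_wpmul2l => //; rewrite lee_fin.
    exact/lefP/nd_nnsfun_approx.
rewrite !lim_g//; congr (limn _); apply/funext => n.
rewrite !integral_weighted_nnsfun//; apply: eq_fsbigr => y _.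
by rewrite hk.
Qed.
End weighted.

(** The expectation of a product of functions of independent variables factors.
    The induction replaces indicators by general functions one index at a time:
    once all factors but [k] are settled, the identity holds for every indicator
    in position [k], and [eq_ge0_integral_weighted] extends it. *)
Lemma mutually_independent_prod (R : realType) d d' (T : measurableType d)
    (T' : measurableType d') (P : probability T R) (I : finType)
    (U : I -> T -> T') (F : I -> T' -> R) :
  (forall i, measurable_fun setT (U i)) -> mutually_independent P U ->
  (forall i, measurable_fun setT (F i)) -> (forall i y, 0 <= F i y) ->
  (\int[P]_w (\prod_i F i (U i w))%:E = \prod_i \int[P]_w (F i (U i w))%:E)%E.
Proof.
move=> mU indU mF F0.
(* [s] lists the indices whose factor need not be an indicator *)
suff H (s : seq I) : forall G : I -> T' -> R, (forall i, measurable_fun setT (G i)) ->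
    (forall i y, 0 <= G i y) ->
    (forall i, i \notin s -> exists2 A, measurable A & G i = \1_A) ->
    (\int[P]_w (\prod_i G i (U i w))%:E = \prod_i \int[P]_w (G i (U i w))%:E)%E.
  by apply: (H (enum I)) => // i; rewrite mem_enum.
elim: s => [|k s IHs] G mG G0 Gs.
  have /boolp.choice[A AP] : forall i, exists A, measurable A /\ G i = \1_A.
    by move=> i; have [A mA GA] := Gs i isT; exists A.
  have mUA i : measurable (U i @^-1` A i).
    by rewrite -[X in measurable X]setTI; apply: (mU i) => //; have [] := AP i.
  have intG i : (\int[P]_w (G i (U i w))%:E = P (U i @^-1` A i))%E.
    rewrite -[X in P X]setIT -integral_indic//=.
    by apply: eq_integral => w _; rewrite (AP i).2.
  rewrite (eq_bigr _ (fun i _ => intG i)) -indU; last by move=> i; have [] := AP i.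
  rewrite -[X in P X]setIT -integral_indic//=; last first.
    by apply: fin_bigcap_measurable => //; exact: finite_finset.
  apply: eq_integral => w _; congr _%:E.
  rewrite indicE; have [/set_mem wA|/negP wA] := boolP (w \in _).
    by rewrite big1// => i _; rewrite (AP i).2 indicE mem_set//; exact: wA.
  apply/eqP/prodf_eq0.
  have [i wi] : exists i, ~ A i (U i w).
    by apply/existsNP => wA'; apply: wA; apply/mem_set => i _; exact: wA'.
  by exists i => //; rewrite (AP i).2 indicE memNset.
(* all factors but the [k]-th: [h] before, [c] after taking expectations *)
pose c := (\prod_(i | i != k) \int[P]_w (G i (U i w))%:E)%E.
have c0 : (0 <= c)%E.
  by apply: prode_ge0 => i _; apply: integral_ge0 => w _; rewrite lee_fin.
pose h w := \prod_(i | i != k) G i (U i w).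
have mh : measurable_fun setT h.
  rewrite /h; under eq_fun do rewrite -big_filter.
  by apply: measurable_prod => i _; exact: measurableT_comp.
have h0 w : 0 <= h w by apply: prodr_ge0.
transitivity (\int[P]_w ((h w)%:E * (G k (U k w))%:E))%E.
  by apply: eq_integral => w _; rewrite (bigD1 k)//= mulrC EFinM.
rewrite (bigD1 k)//= muleC -/c.
transitivity (\int[P]_w (c * (G k (U k w))%:E))%E; last first.
  rewrite ge0_integralZl//.
  - by apply/measurable_EFinP; exact: measurableT_comp.
  - by move=> w _; exact: G0.
apply: (eq_ge0_integral_weighted (f := EFin \o G k)) => //=.
- exact/measurable_EFinP.
- move=> A mA.
  pose G' i := if i == k then \1_A else G i.
  have := IHs G'; rewrite (bigD1 k)//= /G' eqxx.
  have -> : (\prod_(i | i != k) \int[P]_w ((if i == k then \1_A else G i) (U i w))%:E = c)%E.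
    by apply: eq_bigr => i /negbTE ->.
  rewrite ge0_integralZl//; last first.
    apply/measurable_EFinP; apply: measurableT_comp => //.
  rewrite muleC => <-.
  + apply: eq_integral => w _; rewrite -EFinM (bigD1 k)//= eqxx mulrC; congr (_ * _)%:E.
    by apply: eq_bigr => i /negbTE ->.
  + by move=> i; case: ifP.
  + by move=> i y; case: ifP.
  + move=> i si; have [_|ik] := eqVneq i k; first by exists A.
    by apply: Gs; rewrite inE (negbTE ik).
- exact/measurable_EFinP.
- by move=> y; rewrite lee_fin.
Qed.

(** The joint law of independent variables is the product of their laws, so an
    expectation may be computed with an independent copy of the second one. *)
Lemma independent2_decouple (R : realType) d d1 d2 (T : measurableType d)
    (T1 : measurableType d1) (T2 : measurableType d2) (P : probability T R)
    (U : T -> T1) (V : T -> T2) (f : T1 * T2 -> \bar R) :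
  measurable_fun setT U -> measurable_fun setT V -> independent2 P U V ->
  measurable_fun setT f -> (forall z, 0 <= f z)%E ->
  (\int[P]_w f (U w, V w) = \int[P]_w \int[P]_w' f (U w, V w'))%E.
Proof.
move=> mU mV indUV mf f0.
pose U' : {mfun T >-> T1} := HB.pack U (isMeasurableFun.Build _ _ _ _ _ mU).
pose V' : {mfun T >-> T2} := HB.pack V (isMeasurableFun.Build _ _ _ _ _ mV).
have mUV : measurable_fun setT (fun w => (U w, V w)) by exact: measurable_fun_pair.
pose UV : {mfun T >-> (T1 * T2)%type} :=
  HB.pack (fun w => (U w, V w)) (isMeasurableFun.Build _ _ _ _ _ mUV).
transitivity (\int[distribution P UV]_z f z)%E.
  by rewrite ge0_integral_distribution.
rewrite (eq_measure_integral (distribution P U' \x distribution P V')%E); last first.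
  by move=> A mA _; apply/esym; apply: product_measure_unique => // B C mB mC.
rewrite fubini_tonelli1// /fubini_F ge0_integral_distribution//.
- apply: eq_integral => w _ /=; rewrite ge0_integral_distribution//=.
  exact: measurableT_comp.
- exact: measurable_fun_fubini_tonelli_F.
- by move=> x; exact: integral_ge0.
Qed.

Lemma independent2_sym (R : realType) d d1 d2 (T : measurableType d)
    (T1 : measurableType d1) (T2 : measurableType d2) (P : probability T R)
    (U : T -> T1) (V : T -> T2) :
  independent2 P U V -> independent2 P V U.
Proof. by move=> UV A B mA mB; rewrite setIC UV// muleC. Qed.

Lemma identically_distributed_integral (R : realType) d d' (T : measurableType d)
    (T' : measurableType d') (P : probability T R) (U V : {RV P >-> T'})
    (g : T' -> \bar R) :
  identically_distributed U V -> measurable_fun setT g -> (forall y, 0 <= g y)%E ->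
  (\int[P]_w g (U w) = \int[P]_w g (V w))%E.
Proof.
move=> UV mg g0.
transitivity (\int[distribution P U]_y g y)%E.
  by rewrite ge0_integral_distribution.
rewrite (eq_measure_integral (distribution P V)) ?ge0_integral_distribution//.
by move=> A mA _; exact: UV.
Qed.

(** * Exponential inequalities *)

Lemma ge0_derive_ge_init (R : realType) (f df : R -> R) (x : R) :
  (forall y : R, is_derive y 1 f (df y)) -> (forall y, 0 < y -> 0 <= df y) ->
  0 <= x -> f 0 <= f x.
Proof.
move=> fdf df0; rewrite le_eqVlt => /predU1P[<-//|x0].
have fd y : y \in `]0, x[ -> is_derive y 1 f (df y) by [].
have cf : {within `[0, x], continuous f}.
  by apply: derivable_within_continuous => y _; have [] := fdf y.
have [c] := MVT x0 fd cf.
rewrite in_itv/= => /andP[c0 _] fE.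
by rewrite -subr_ge0 fE mulr_ge0 ?df0// subr0 ltW.
Qed.

(** It suffices that [exp (x - x^2/2) + exp (- x - x^2/2)] decreases on the
    positive half-line; its derivative has the sign opposite to that of
    [(x - 1) exp (2x) + 1 + x], which vanishes at 0 and is itself increasing. *)
Lemma cosh_le_expR_sqr (R : realType) (x : R) :
  0 <= x -> expR x + expR (- x) <= 2 * expR (x ^+ 2 / 2).
Proof.
move=> x0.
have k_ge0 (y : R) : 0 <= y -> 0 <= (y - 1) * expR (2 * y) + 1 + y.
  move=> y0; pose k (z : R) := (z - 1) * expR (2 * z) + 1 + z.
  pose dk (z : R) := 1 - (1 - 2 * z) * expR (2 * z).
  suff : k 0 <= k y by rewrite /k !mulr0 expR0; lra.
  apply: (@ge0_derive_ge_init _ _ dk) => // [z|z z0].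
    apply: is_derive_eq; rewrite /dk /GRing.scale/=; ring.
  rewrite /dk subr_ge0 -(@ler_pM2r _ (expR (- (2 * z)))) ?expR_gt0//.
  rewrite -mulrA -expRD subrr expR0 mulr1 mul1r.
  by have := expR_ge1Dx (- (2 * z)); lra.
pose h (z : R) := - (expR (z - z ^+ 2 / 2) + expR (- z - z ^+ 2 / 2)).
pose dh (z : R) :=
  expR (- z - z ^+ 2 / 2) * ((z - 1) * expR (2 * z) + 1 + z).
have : h 0 <= h x.
  apply: (@ge0_derive_ge_init _ _ dh) => // [z|z z0].
    apply: is_derive_eq; rewrite /dh /GRing.scale/=.
    have -> : z - z ^+ 2 / 2 = (- z - z ^+ 2 / 2) + 2 * z by ring.
    by rewrite expRD; field.
  by rewrite /dh mulr_ge0 ?expR_ge0// k_ge0// ltW.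
rewrite /h !expRD expr0n/= !mul0r !oppr0 expR0 -mulrDl expRN.
rewrite -(@ler_pM2r _ (expR (x ^+ 2 / 2))) ?expR_gt0//.
have := expR_gt0 (x ^+ 2 / 2); set e := expR (x ^+ 2 / 2) => e0.
have -> : - (expR x / e + expR (- x) / e) * e = - (expR x + expR (- x)).
  by field; rewrite gt_eqF.
lra.
Qed.

(** Between [- a] and [a] the exponential lies below its chord, whose value at 0
    is [cosh a <= exp (a^2/2)].  The linear term averages out when the bound is
    applied to a centred variable. *)
Lemma expR_le_affine (R : realType) (a : R) : 0 <= a ->
  exists k : R, forall y, `|y| <= a -> expR y <= expR (a ^+ 2 / 2) + k * y.
Proof.
rewrite le_eqVlt => /predU1P[<-|a0].
  by exists 0 => y; rewrite normr_le0 => /eqP ->; rewrite expr0n !mul0r addr0.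
exists ((expR a - expR (- a)) / (2 * a)) => y; rewrite ler_norml => /andP[ay ya].
have t01 : 0 <= (y + a) / (2 * a) <= 1.
  by apply/andP; split; [apply: divr_ge0|rewrite ler_pdivrMr]; lra.
set t := (y + a) / (2 * a) in t01.
have cvx : expR (t * a + (1 - t) * - a) <= t * expR a + (1 - t) * expR (- a).
  by have := convex_expR (Itv01 (andP t01).1 (andP t01).2) (a : R^o) (- a : R^o);
     rewrite !convRE.
rewrite (_ : y = t * a + (1 - t) * - a); last by rewrite /t; field; rewrite gt_eqF.
apply: (le_trans cvx).
have := cosh_le_expR_sqr (ltW a0).
set c := expR (a ^+ 2 / 2) => ac.
have -> : t * expR a + (1 - t) * expR (- a) =
    (expR a + expR (- a)) / 2 +
    (expR a - expR (- a)) / (2 * a) * (t * a + (1 - t) * - a).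
  by field; rewrite gt_eqF.
rewrite lerD2r; lra.
Qed.

(** * Moment generating functions *)

Lemma ae_bounded_integrable (R : realType) d (T : measurableType d)
    (P : probability T R) (W : T -> R) (c : R) :
  measurable_fun setT W -> {ae P, forall w, `|W w| <= c} ->
  P.-integrable setT (EFin \o W).
Proof.
move=> mW Wc; apply/integrableP; split; first exact/measurable_EFinP.
apply: (@le_lt_trans _ _ (\int[P]_w (`|c|)%:E)%E); last first.
  by rewrite integral_cst//= probability_setT mule1 ltry.
apply: ae_ge0_le_integral => //.
- by apply: measurableT_comp => //; exact/measurable_EFinP.
- move: Wc; apply: filterS => w Wc _.
  by rewrite lee_fin (le_trans Wc)// ler_norm.
Qed.

(** Hoeffding's lemma: the linear part of [expR_le_affine] has mean zero. *)
Lemma centered_bounded_mgf (R : realType) d (T : measurableType d)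
    (P : probability T R) (W : T -> R) (c t : R) :
  0 <= c -> measurable_fun setT W -> {ae P, forall w, `|W w| <= c} ->
  (\int[P]_w (W w)%:E = 0)%E ->
  (\int[P]_w (expR (t * W w))%:E <= (expR (t ^+ 2 * c ^+ 2 / 2))%:E)%E.
Proof.
move=> c0 mW Wc W0.
have [k kP] := expR_le_affine (mulr_ge0 (normr_ge0 t) c0).
have -> : t ^+ 2 * c ^+ 2 / 2 = (`|t| * c) ^+ 2 / 2.
  by rewrite exprMn real_normK ?num_real.
set e := expR _ in kP *.
have le_g : {ae P, forall w, expR (t * W w) <= e + k * t * W w}.
  move: Wc; apply: filterS => w Wc; rewrite -mulrA; apply: kP.
  by rewrite normrM ler_wpM2l.
have intW := ae_bounded_integrable mW Wc.
have mg : measurable_fun setT (fun w => e + k * t * W w).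
  by apply: measurable_funD => //; apply: measurable_funM.
apply: (@le_trans _ _ (\int[P]_w (`|e + k * t * W w|)%:E)%E).
  apply: ae_ge0_le_integral => //.
  - apply/measurable_EFinP; apply: measurableT_comp => //.
    exact: measurable_funM.
  - apply/measurable_EFinP; exact: measurableT_comp.
  - move: le_g; apply: filterS => w wg _; rewrite lee_fin (le_trans wg)// ler_norm//.
(* the affine bound is nonnegative almost everywhere only, whence the detour
   through its absolute value *)
have -> : (\int[P]_w (`|e + k * t * W w|)%:E = \int[P]_w (e + k * t * W w)%:E)%E.
  apply: ae_eq_integral => //.
  - apply/measurable_EFinP; exact: measurableT_comp.
  - exact/measurable_EFinP.
  - move: le_g; apply: filterS => w wg _; rewrite ger0_norm//.
    by rewrite (le_trans _ wg)// expR_ge0.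
under eq_integral do rewrite EFinD EFinM.
rewrite integralD//=.
- rewrite integral_cst//= probability_setT mule1 integralZl// W0 mule0 adde0//.
- by apply/finite_measure_integrable_cst.
- by apply: integrableZl.
Qed.

(** Completing the square: exponential tilting translates a Gaussian density. *)
Lemma normal_pdf_expR (R : realType) (s t x : R) : s != 0 ->
  normal_pdf 0 s x * expR (t * x) =
  expR (t ^+ 2 * s ^+ 2 / 2) * normal_pdf (s ^+ 2 * t) s x.
Proof.
move=> s0; rewrite !normal_pdfE// /normal_fun mulrAC -mulrA -expRD.
rewrite [RHS]mulrCA -expRD mulr2n; congr (_ * expR _).
by field; rewrite -mulr2n mulrn_eq0 sqrf_eq0.
Qed.

Lemma gaussian_mgf (R : realType) d (T : measurableType d)
    (P : probability T R) (eps : {RV P >-> R}) (s t : R) :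
  has_law eps (gaussian_law s) ->
  (\int[P]_w (expR (t * eps w))%:E = (expR (t ^+ 2 * s ^+ 2 / 2))%:E)%E.
Proof.
rewrite /has_law /gaussian_law.
have mexp : measurable_fun setT (fun x : R => (expR (t * x))%:E).
  apply/measurable_EFinP; apply: measurableT_comp => //.
have [-> law0|s0 laws] := eqVneq s 0.
  transitivity (\int[distribution P eps]_x (expR (t * x))%:E)%E.
    by rewrite ge0_integral_distribution// => y; rewrite lee_fin expR_ge0.
  rewrite (eq_measure_integral (\d_(0 : R))); last by move=> A mA _; exact: law0.
  by rewrite integral_dirac// diracT mul1e !(mulr0, mul0r, expr0n).
transitivity (\int[P]_w (1 * (expR (t * eps w))%:E))%E.
  by apply: eq_integral => w _; rewrite mul1e.
rewrite (@eq_ge0_integral_weighted _ _ _ _ _ _ _ P lebesgue_measure eps id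
  (cst 1%E) (EFin \o normal_pdf 0 s) (fun x => (expR (t * x))%:E))//=.
- under eq_integral do rewrite -EFinM normal_pdf_expR// EFinM.
  rewrite ge0_integralZl//=; last 2 first.
  + by apply/measurable_EFinP; exact: measurable_normal_pdf.
  + by move=> x _; rewrite lee_fin normal_pdf_ge0.
  by rewrite integral_normal_pdf mule1.
- by apply/measurable_EFinP; exact: measurable_normal_pdf.
- by move=> x; rewrite lee_fin normal_pdf_ge0.
- move=> A mA; under eq_integral do rewrite mul1e.
  transitivity (distribution P eps A).
    have meA : measurable (eps @^-1` A) by exact: measurable_funPTI.
    by rewrite -[RHS]/(P (eps @^-1` A)) -[X in P X]setIT -integral_indic.
  rewrite laws// /normal_prob integral_mkcond; apply: eq_integral => x _.
  rewrite patchE indicE; case: ifPn => _; first by rewrite mule1.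
  by rewrite mule0.
Qed.

(** A variable bounded by [c] deviates from its mean by at most [2 c]. *)
Lemma bounded_deviation_mgf (R : realType) d (T : measurableType d)
    (P : probability T R) (W : T -> R) (c u : R) :
  measurable_fun setT W -> {ae P, forall w, `|W w| <= c} -> 0 <= c ->
  (\int[P]_w (expR (u * (fine (\int[P]_w (W w)%:E) - W w)))%:E <=
     (expR (u ^+ 2 * (2 * c) ^+ 2 / 2))%:E)%E.
Proof.
move=> mW Wc c0; have intW := ae_bounded_integrable mW Wc.
have finW := integrable_fin_num measurableT intW.
set m := fine _.
have mE : (\int[P]_w (W w)%:E = m%:E)%E by rewrite fineK.
have mc : `|m| <= c.
  rewrite -lee_fin -abse_EFin -mE.
  apply: (le_trans (le_abse_integral _ _ _)) => //; first exact/measurable_EFinP.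
  apply: (@le_trans _ _ (\int[P]_w c%:E)%E); last first.
    by rewrite integral_cst//= probability_setT mule1.
  apply: ae_ge0_le_integral => //.
  - by apply: measurableT_comp => //; exact/measurable_EFinP.
  - by move: Wc; apply: filterS => w Wc _; rewrite lee_fin.
apply: centered_bounded_mgf.
- by rewrite mulr_ge0.
- exact: measurable_funB.
- move: Wc; apply: filterS => w Wc.
  by apply: (le_trans (ler_normB _ _)); lra.
under eq_integral do rewrite EFinB.
rewrite integralB//; last exact: finite_measure_integrable_cst.
rewrite integral_cst//= probability_setT mule1.
by rewrite [X in (_ - X)%E]mE subee.
Qed.

(** Conditionally on [X], the product is a centred Gaussian variable of variance
    at most [sigma^2 M^2]. *)
Lemma gaussian_mul_bounded_mgf (R : realType) d d' (T : measurableType d)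
    (T' : measurableType d') (P : probability T R) (eps : {RV P >-> R})
    (X : {RV P >-> T'}) (h : T' -> R) (sigma M u : R) :
  has_law eps (gaussian_law sigma) -> independent2 P eps X ->
  measurable_fun setT h -> {ae P, forall w, `|h (X w)| <= M} ->
  (\int[P]_w (expR (u * (eps w * h (X w))))%:E <=
    (expR (u ^+ 2 * (sigma * M) ^+ 2 / 2))%:E)%E.
Proof.
move=> geps indep mh hM.
have mhX : measurable_fun setT (fun w => h (X w)) by exact: measurableT_comp.
have mf : measurable_fun setT
    (fun z : T' * R => (expR (u * (z.2 * h z.1)))%:E).
  apply/measurable_EFinP; apply: measurableT_comp => //.
  apply: measurable_funM => //; apply: measurable_funM => //.
  exact: measurableT_comp.
rewrite (independent2_decouple (U := X) (V := eps)
  (f := fun z : T' * R => (expR (u * (z.2 * h z.1)))%:E))//; last first.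
  exact: independent2_sym.
have inner w : (\int[P]_w' (expR (u * (eps w' * h (X w))))%:E =
    (expR ((u * h (X w)) ^+ 2 * sigma ^+ 2 / 2))%:E)%E.
  rewrite -(gaussian_mgf _ geps); apply: eq_integral => w' _.
  by rewrite mulrCA mulrC -mulrA mulrC -mulrA [h _ * _]mulrC.
under eq_integral do rewrite inner.
apply: (@le_trans _ _ (\int[P]_w (expR (u ^+ 2 * (sigma * M) ^+ 2 / 2))%:E)%E).
  apply: ae_ge0_le_integral => //.
  - apply/measurable_EFinP; apply: measurableT_comp => //.
    apply: measurable_funM => //; apply: measurable_funM => //.
    by apply: measurable_funX; apply: measurable_funM.
  - move: hM; apply: filterS => w hM _; rewrite lee_fin ler_expR.
    have hM2 : h (X w) ^+ 2 <= M ^+ 2.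
      by rewrite -[leLHS]real_normK ?num_real// lerXn2r ?nnegrE// (le_trans _ hM).
    have := ler_wpM2l (mulr_ge0 (sqr_ge0 u) (sqr_ge0 sigma)) hM2; lra.
by rewrite integral_cst//= probability_setT mule1.
Qed.

(** The generating function of the sum is the [n]-th power of the common one, so
    subgaussian parameters add in squares. *)
Lemma iid_sum_mgf (R : realType) d d' (T : measurableType d)
    (T' : measurableType d') (P : probability T R) (n : nat)
    (Z : {RV P >-> T'}) (Zs : 'I_n -> {RV P >-> T'}) (g : T' -> R) (s : R) :
  (forall i, identically_distributed (Zs i) Z) ->
  mutually_independent P (fun i => (Zs i : T -> T')) ->
  measurable_fun setT g ->
  (forall u : R,
    \int[P]_w (expR (u * g (Z w)))%:E <= (expR (u ^+ 2 * s ^+ 2 / 2))%:E)%E ->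
  forall u : R,
  (\int[P]_w (expR (u * \sum_(i < n) g (Zs i w)))%:E <=
    (expR (u ^+ 2 * (Num.sqrt n%:R * s) ^+ 2 / 2))%:E)%E.
Proof.
move=> ZsZ indZs mg sgZ u.
pose F z := expR (u * g z).
have mF : measurable_fun setT F.
  by apply: measurableT_comp => //; exact: measurable_funM.
have F0 z : 0 <= F z by exact: expR_ge0.
have -> : (\int[P]_w (expR (u * \sum_(i < n) g (Zs i w)))%:E =
    \int[P]_w (\prod_(i < n) F (Zs i w))%:E)%E.
  by apply: eq_integral => w _; rewrite mulr_sumr expR_sum.
rewrite (@mutually_independent_prod _ _ _ _ _ P _ (fun i => (Zs i : T -> T'))
  (fun=> F))//.
have intF i : (\int[P]_w (F (Zs i w))%:E = \int[P]_w (F (Z w))%:E)%E.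
  apply: (identically_distributed_integral (g := EFin \o F)) => //.
    exact/measurable_EFinP.
rewrite (eq_bigr _ (fun i _ => intF i)).
have F1 := sgZ u.
have [r r0 rE] : exists2 r : R, 0 <= r & (\int[P]_w (F (Z w))%:E = r%:E)%E.
  have i0 : (0 <= \int[P]_w (F (Z w))%:E)%E by apply: integral_ge0 => w _; rewrite lee_fin.
  exists (fine (\int[P]_w (F (Z w))%:E)%E); first exact: fine_ge0.
  by rewrite fineK// ge0_fin_numE// (le_lt_trans F1)// ltry.
rewrite rE prodEFin lee_fin prodr_const card_ord.
rewrite exprMn sqr_sqrtr ?ler0n//.
have -> : u ^+ 2 * (n%:R * s ^+ 2) / 2 = n%:R * (u ^+ 2 * s ^+ 2 / 2) by ring.
rewrite expRM_natl lerXn2r ?nnegrE ?expR_ge0//.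
by move: F1; rewrite rE lee_fin.
Qed.

(** * The expected maximum of subgaussian variables *)

Lemma measurable_bigmaxr (R : realType) d (T : measurableType d) (I : Type)
    (s : seq I) (f : I -> T -> R) :
  (forall i, measurable_fun setT (f i)) ->
  measurable_fun setT (fun w => \big[Num.max/0]_(i <- s) f i w).
Proof.
move=> mf; elim: s => [|i s IHs].
  by under eq_fun do rewrite big_nil; exact: measurable_cst.
by under eq_fun do rewrite big_cons; exact: measurable_maxr.
Qed.

(** With [S = sum_a (exp (t W_a) + exp (- t W_a))], each [t |W_a|] is at most
    [ln S].  Bounding the concave logarithm by its tangent at [exp L], where
    [exp L] dominates the expectation of [S], avoids Jensen's inequality. *)
Lemma expectation_max_le_tilt (R : realType) d (T : measurableType d)
    (P : probability T R) (I : finType) (W : I -> T -> R) (s t : R) :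
  (0 < #|I|)%N -> 0 < t -> (forall a, measurable_fun setT (W a)) ->
  (forall a (u : R),
    \int[P]_w (expR (u * W a w))%:E <= (expR (u ^+ 2 * s ^+ 2 / 2))%:E)%E ->
  (\int[P]_w (\big[Num.max/0]_a `|W a w|)%:E <=
    (ln (2 * #|I|%:R) / t + t * s ^+ 2 / 2)%:E)%E.
Proof.
move=> I0 t0 mW sgW.
set N : R := 2 * #|I|%:R.
have N1 : 1 <= N.
  have : 1 <= #|I|%:R :> R by rewrite ler1n.
  by rewrite /N; lra.
have N0 : 0 < N by lra.
pose L := ln N + t ^+ 2 * s ^+ 2 / 2.
have L0 : 0 <= L.
  by rewrite addr_ge0 ?ln_ge0// divr_ge0// mulr_ge0// sqr_ge0.
pose S w := \sum_a (expR (t * W a w) + expR (- t * W a w)).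
have mexp u a : measurable_fun setT (fun w => expR (u * W a w)).
  by apply: measurableT_comp => //; apply: measurable_funM.
have mS : measurable_fun setT S.
  by apply: measurable_sum => a; exact: measurable_funD.
have S0 w : 0 <= S w by apply: sumr_ge0 => a _; rewrite addr_ge0// expR_ge0.
have eL0 := expR_gt0 L.
have mmax : measurable_fun setT (fun w => \big[Num.max/0]_a `|W a w|).
  by apply: measurable_bigmaxr => a; exact: measurableT_comp.
have max0 w : 0 <= \big[Num.max/0]_a `|W a w| by exact: bigmax_ge_id.
(* [1 + y <= expR y], used at [y = t * max - L] *)
have tangent w : t * (\big[Num.max/0]_a `|W a w|) + 1 <= L + S w / expR L.
  rewrite -lerBrDr -ler_pdivlMl//.
  have bound (x : R) : expR x <= S w -> x <= L + S w / expR L - 1.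
    move=> xS; have := expR_ge1Dx (x - L); rewrite expRB => h.
    have : expR x / expR L <= S w / expR L by rewrite ler_pM2r ?invr_gt0.
    by lra.
  apply/bigmax_leP; split=> [|a _].
    (* the default value 0 of the maximum: [1 <= S w] as [I] is inhabited *)
    rewrite mulr_ge0// ?invr_ge0 ?(ltW t0)//; apply: bound; rewrite expR0.
    have /card_gt0P[a _] := I0.
    rewrite /S (bigD1 a)//=.
    have h1 := expR_ge1Dx (t * W a w); have h2 := expR_ge1Dx (- t * W a w).
    have : 0 <= \sum_(i | i != a) (expR (t * W i w) + expR (- t * W i w)).
      by apply: sumr_ge0 => i _; rewrite addr_ge0// expR_ge0.
    by lra.
  rewrite ler_pdivlMl//; apply: bound.
  rewrite /S (bigD1 a)//=.
  have h1 := expR_ge0 (t * W a w); have h2 := expR_ge0 (- t * W a w).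
  have : 0 <= \sum_(i | i != a) (expR (t * W i w) + expR (- t * W i w)).
    by apply: sumr_ge0 => i _; rewrite addr_ge0// expR_ge0.
  have [Wa|Wa] := ger0P (W a w); first by lra.
  rewrite mulrN -mulNr; lra.
have intS : (\int[P]_w (S w)%:E <= (expR L)%:E)%E.
  have -> : (\int[P]_w (S w)%:E = \sum_a (\int[P]_w (expR (t * W a w))%:E +
      \int[P]_w (expR (- t * W a w))%:E))%E.
    rewrite /S; under eq_integral do rewrite -sumEFin.
    rewrite ge0_integral_sum//; last first.
      by move=> a; apply/measurable_EFinP; exact: measurable_funD.
    apply: eq_bigr => a _; under eq_integral do rewrite EFinD.
    rewrite ge0_integralD//; exact/measurable_EFinP.
  apply: (@le_trans _ _ (\sum_(a : I) (2 * expR (t ^+ 2 * s ^+ 2 / 2))%:E)%E).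
    apply: lee_sum => a _; rewrite mulr_natl mulr2n EFinD leeD//.
    by have := sgW a (- t); rewrite sqrrN.
  rewrite sumEFin lee_fin sumr_const /L expRD lnK ?posrE//.
  by rewrite /N -mulr_natl; lra.
have : (\int[P]_w (t * (\big[Num.max/0]_a `|W a w|) + 1)%:E <=
    \int[P]_w (L + S w / expR L)%:E)%E.
  apply: ge0_le_integral => //.
  - by move=> w _; rewrite lee_fin addr_ge0// mulr_ge0// ltW.
  - apply/measurable_EFinP; apply: measurable_funD => //.
    exact: measurable_funM.
  - apply/measurable_EFinP; apply: measurable_funD => //.
    exact: measurable_funM.
  - by move=> w _; rewrite lee_fin.
under eq_integral do rewrite EFinD EFinM.
under [leRHS]eq_integral do rewrite EFinD mulrC EFinM.
have mmaxe : measurable_fun setT (fun w => (\big[Num.max/0]_a `|W a w|)%:E).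
  exact/measurable_EFinP.
have mSe : measurable_fun setT (fun w => (S w)%:E) by exact/measurable_EFinP.
have t0e : (0 <= t%:E)%E by rewrite lee_fin ltW.
rewrite !ge0_integralD//; do ?[exact: measurable_funeM];
  do ?[by move=> w _; rewrite -EFinM lee_fin mulr_ge0// ?invr_ge0 ltW].
rewrite !ge0_integralZl//; do ?[by move=> w _; rewrite lee_fin].
rewrite !integral_cst//= probability_setT !mule1 => h.
have {h} : (t%:E * \int[P]_w (\big[Num.max/0]_a `|W a w|)%:E + 1 <= (L + 1)%:E)%E.
  apply: (le_trans h); rewrite [leRHS]EFinD; apply: leeD2l.
  apply: (@le_trans _ _ (((expR L)^-1)%:E * (expR L)%:E)%E).
    by apply: lee_wpmul2l => //; rewrite lee_fin invr_ge0 ltW.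
  by rewrite -EFinM mulVf ?gt_eqF.
case: (\int[P]_w _)%E => [m| |].
- rewrite -EFinM -EFinD !lee_fin lerD2r => tm.
  rewrite -(@ler_pM2l _ t)//; apply: (le_trans tm).
  by rewrite le_eqVlt; apply/orP; left; apply/eqP; rewrite /L; field; rewrite gt_eqF.
- by rewrite gt0_muley.
- by rewrite leNye.
Qed.

(** The choice [t = sqrt (2 ln (2N)) / s] is optimal in
    [expectation_max_le_tilt]; for [s = 0] one lets [t] tend to infinity. *)
Lemma expectation_max_subgaussian (R : realType) d (T : measurableType d)
    (P : probability T R) (I : finType) (W : I -> T -> R) (s : R) :
  (0 < #|I|)%N -> 0 <= s -> (forall a, measurable_fun setT (W a)) ->
  (forall a (u : R),
    \int[P]_w (expR (u * W a w))%:E <= (expR (u ^+ 2 * s ^+ 2 / 2))%:E)%E ->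
  (\int[P]_w (\big[Num.max/0]_a `|W a w|)%:E <=
    (s * Num.sqrt (2 * ln (2 * #|I|%:R)))%:E)%E.
Proof.
move=> I0 s0 mW sgW.
have tilt t (t0 : 0 < t) := expectation_max_le_tilt I0 t0 mW sgW.
have lnN0 : 0 < ln (2 * #|I|%:R : R).
  rewrite ln_gt0//; have : 1 <= #|I|%:R :> R by rewrite ler1n.
  by lra.
have [s_eq0|s_neq0] := eqVneq s 0.
  rewrite s_eq0 mul0r; apply/lee_addgt0Pr => e e0; rewrite add0e.
  apply: (le_trans (tilt (ln (2 * #|I|%:R) / e) _)); first exact: divr_gt0.
  rewrite lee_fin s_eq0 expr0n/= mulr0 mul0r addr0 invf_div mulrCA divff ?mulr1//.
  by rewrite gt_eqF.
have s_gt0 : 0 < s by rewrite lt_neqAle eq_sym s_neq0.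
set r := Num.sqrt _.
have r0 : 0 < r by rewrite sqrtr_gt0 mulr_gt0.
have r2 : r ^+ 2 = 2 * ln (2 * #|I|%:R) by rewrite sqr_sqrtr// ltW// mulr_gt0.
apply: (le_trans (tilt (r / s) _)); first exact: divr_gt0.
rewrite lee_fin (_ : ln _ = r ^+ 2 / 2); last by rewrite r2; field.
rewrite le_eqVlt; apply/orP; left; apply/eqP.
by field; rewrite !gt_eqF.
Qed.

(** * Deterministic inequalities for the Lasso *)

Section deterministic.
Context {R : realType} {p n : nat}.
Implicit Types (b c x : p.-tuple R) (z : n.-tuple (R * p.-tuple R)).

Lemma dotpB b c x :
  dotp b x - dotp c x = \sum_(j < p) (tnth b j - tnth c j) * tnth x j.
Proof. by rewrite -sumrB; apply: eq_bigr => j _; rewrite mulrBl. Qed.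

Definition segment b c (t : R) : p.-tuple R :=
  [tuple tnth b j + t * (tnth c j - tnth b j) | j < p].

Lemma dotp_segment b c t x :
  dotp (segment b c t) x = dotp b x + t * (dotp c x - dotp b x).
Proof.
rewrite dotpB mulr_sumr -big_split; apply: eq_bigr => j _ /=.
by rewrite tnth_mktuple mulrDl mulrA.
Qed.

Lemma norm1_segment (K : R) b c t : 0 <= t <= 1 ->
  norm1 b <= K -> norm1 c <= K -> norm1 (segment b c t) <= K.
Proof.
move=> /andP[t0 t1] bK cK.
apply: (@le_trans _ _ ((1 - t) * norm1 b + t * norm1 c)); last first.
  have -> : K = (1 - t) * K + t * K by ring.
  by rewrite lerD// ler_wpM2l// subr_ge0.
rewrite /norm1 !mulr_sumr -big_split; apply: ler_sum => j _ /=.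
rewrite tnth_mktuple.
rewrite (_ : tnth b j + _ = (1 - t) * tnth b j + t * tnth c j); last by ring.
apply: (le_trans (ler_normD _ _)); rewrite !normrM.
by rewrite (ger0_norm t0) ger0_norm ?subr_ge0.
Qed.

Lemma le0_of_le_scaled (a q : R) :
  (forall t, 0 < t <= 1 -> a <= t * q) -> a <= 0.
Proof.
move=> h; rewrite leNgt; apply/negP => a0.
have q0 : 0 < q by have := h 1; rewrite ltr01 lexx mul1r => /(_ isT); lra.
have aq : a <= q by have := h 1; rewrite ltr01 lexx mul1r => /(_ isT).
(* at [t = a / (2 q)], which is at most 1, the hypothesis reads [a <= a / 2] *)
have := h (a / (2 * q)); rewrite divr_gt0 ?mulr_gt0//= ler_pdivrMr ?mulr_gt0// mul1r.
have -> : a / (2 * q) * q = a / 2 by field; rewrite gt_eqF.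
have aq2 : a <= 2 * q by lra.
by rewrite aq2 => /(_ isT); lra.
Qed.

(** The first-order optimality condition for least squares over a convex set,
    that is, the obtuse angle property of projections: compare [b] with the
    point at parameter [t] on the segment from [b] to [c] and let [t] tend
    to 0. *)
Lemma lasso_basic_inequality (K : R) z b c :
  lasso_minimizer K z b -> norm1 c <= K ->
  \sum_(i < n) (dotp c (tnth z i).2 - dotp b (tnth z i).2) ^+ 2 <=
  \sum_(i < n) ((tnth z i).1 - dotp c (tnth z i).2) *
     (dotp b (tnth z i).2 - dotp c (tnth z i).2).
Proof.
move=> [bK bmin] cK; rewrite -subr_le0 -sumrB.
set a := \sum_(i < n) _.
rewrite -(@pmulr_rle0 _ 2)//.
apply: (@le0_of_le_scaled _
  (\sum_(i < n) (dotp c (tnth z i).2 - dotp b (tnth z i).2) ^+ 2)) => t t01.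
have /andP[t0 t1] := t01.
have := bmin _ (@norm1_segment K b c t _ bK cK).
rewrite (ltW t0) t1 => /(_ isT).
rewrite -subr_ge0 /rss -sumrB => h.
rewrite -subr_ge0 -(pmulr_rge0 _ t0); apply: (le_trans h).
rewrite /a mulrBr !mulr_sumr -sumrB; apply: ler_sum => i _.
rewrite dotp_segment le_eqVlt; apply/orP; left; apply/eqP.
ring.
Qed.

Lemma norm1_sub_le (K : R) b c : norm1 b <= K -> norm1 c <= K ->
  \sum_(j < p) `|tnth b j - tnth c j| <= 2 * K.
Proof.
move=> bK cK; apply: (@le_trans _ _ (norm1 b + norm1 c)); last by lra.
by rewrite -big_split; apply: ler_sum => j _; exact: ler_normB.
Qed.

Lemma sum_le_norm_max (I : finType) (d u : I -> R) (D : R) :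
  \sum_i `|d i| <= D ->
  \sum_i d i * u i <= D * \big[Num.max/0]_i `|u i|.
Proof.
move=> dD; have max0 : 0 <= \big[Num.max/0]_i `|u i| by exact: bigmax_ge_id.
apply: (le_trans _ (ler_wpM2r max0 dD)); rewrite mulr_suml; apply: ler_sum => i _.
apply: (le_trans (ler_norm _)); rewrite normrM ler_wpM2l//.
exact: le_bigmax.
Qed.

(** Duality between the l1-norm and the maximum norm bounds the error uniformly
    over the l1-ball, by quantities free of the estimator [b], whose dependence
    on the data is intractable.  In the application [m] holds the second moments
    of the covariates. *)
Lemma lasso_error_bound (K : R) z b c (m : 'I_p -> 'I_p -> R) :
  (0 < n)%N -> lasso_minimizer K z b -> norm1 c <= K ->
  \sum_(j < p) \sum_(k < p)
     (tnth c j - tnth b j) * (tnth c k - tnth b k) * m j k <=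
  2 * K / n%:R * \big[Num.max/0]_(j < p)
     `|\sum_(i < n) ((tnth z i).1 - dotp c (tnth z i).2) * tnth (tnth z i).2 j| +
  4 * K ^+ 2 * \big[Num.max/0]_(a : 'I_p * 'I_p)
     `|\sum_(i < n) n%:R^-1 *
        (m a.1 a.2 - tnth (tnth z i).2 a.1 * tnth (tnth z i).2 a.2)|.
Proof.
move=> n0 zb cK; have [bK _] := zb.
have nR0 : 0 < n%:R :> R by rewrite ltr0n.
have basic := lasso_basic_inequality zb cK.
pose x i := (tnth z i).2.
pose e i := (tnth z i).1 - dotp c (x i).
pose dl j := tnth c j - tnth b j.
have dlK : \sum_j `|dl j| <= 2 * K by exact: norm1_sub_le.
pose V j k := \sum_(i < n) n%:R^-1 * (m j k - tnth (x i) j * tnth (x i) k).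
have VE j k : V j k = m j k - n%:R^-1 * \sum_(i < n) tnth (x i) j * tnth (x i) k.
  rewrite /V -mulr_sumr sumrB sumr_const card_ord -[m j k *+ n]mulr_natl mulrBr.
  by rewrite mulKf// gt_eqF.
have sqE : \sum_(i < n) (dotp c (x i) - dotp b (x i)) ^+ 2 =
    \sum_j \sum_k dl j * dl k * \sum_(i < n) tnth (x i) j * tnth (x i) k.
  transitivity (\sum_(i < n) \sum_j \sum_k
      dl j * dl k * (tnth (x i) j * tnth (x i) k)).
    apply: eq_bigr => i _; rewrite dotpB expr2 mulr_suml; apply: eq_bigr => j _.
    by rewrite mulr_sumr; apply: eq_bigr => k _; rewrite mulrACA.
  rewrite exchange_big; apply: eq_bigr => j _ /=.
  by rewrite exchange_big; apply: eq_bigr => k _; rewrite mulr_sumr.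
have -> : \sum_(j < p) \sum_(k < p) dl j * dl k * m j k =
    n%:R^-1 * (\sum_(i < n) (dotp c (x i) - dotp b (x i)) ^+ 2) +
    \sum_(a : 'I_p * 'I_p) (dl a.1 * dl a.2) * V a.1 a.2.
  rewrite -(pair_bigA _ (fun j k => dl j * dl k * V j k))/= sqE.
  rewrite mulr_sumr -big_split; apply: eq_bigr => j _ /=.
  rewrite mulr_sumr -big_split; apply: eq_bigr => k _ /=.
  by rewrite VE; ring.
apply: lerD; last first.
  apply: (@sum_le_norm_max _ (fun a => dl a.1 * dl a.2) (fun a => V a.1 a.2)).
  rewrite -(pair_bigA _ (fun j k => `|dl j * dl k|))/=.
  have -> : 4 * K ^+ 2 = (2 * K) * (2 * K) by ring.
  have -> : \sum_i \sum_j `|dl i * dl j| = (\sum_i `|dl i|) * (\sum_j `|dl j|).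
    rewrite mulr_suml; apply: eq_bigr => i _; rewrite mulr_sumr.
    by apply: eq_bigr => j _; rewrite normrM.
  by apply: ler_pM => //; apply: sumr_ge0.
rewrite (mulrC (2 * K)) -mulrA ler_pM2l ?invr_gt0//.
apply: (le_trans basic).
have -> : \sum_(i < n) e i * (dotp b (x i) - dotp c (x i)) =
    \sum_(j < p) (tnth b j - tnth c j) * (\sum_(i < n) e i * tnth (x i) j).
  under eq_bigr do rewrite dotpB mulr_sumr.
  rewrite exchange_big; apply: eq_bigr => j _; rewrite mulr_sumr.
  by apply: eq_bigr => i _; rewrite mulrCA.
apply: sum_le_norm_max; exact: norm1_sub_le.
Qed.

End deterministic.

(** * The mean squared prediction error *)

Lemma measurable_dotp (R : realType) d (T : measurableType d) (p : nat)
    (f g : T -> p.-tuple R) :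
  measurable_fun setT f -> measurable_fun setT g ->
  measurable_fun setT (fun w => dotp (f w) (g w)).
Proof.
move=> mf mg; apply: measurable_sum => j; apply: measurable_funM.
  exact: (measurableT_comp (measurable_tnth j) mf).
exact: (measurableT_comp (measurable_tnth j) mg).
Qed.

Lemma integral_dotp_sqr (R : realType) d (T : measurableType d)
    (P : probability T R) (p : nat) (X : T -> p.-tuple R) (b c : p.-tuple R) :
  (forall j k, P.-integrable setT (fun w => (tnth (X w) j * tnth (X w) k)%:E)) ->
  (\int[P]_w ((dotp c (X w) - dotp b (X w)) ^+ 2)%:E =
    (\sum_(j < p) \sum_(k < p) (tnth c j - tnth b j) * (tnth c k - tnth b k) *
       fine (\int[P]_w (tnth (X w) j * tnth (X w) k)%:E)%E)%:E)%E.
Proof.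
move=> intX.
transitivity (\int[P]_w (\sum_(j < p) \sum_(k < p)
    ((tnth c j - tnth b j) * (tnth c k - tnth b k))%:E *
      (tnth (X w) j * tnth (X w) k)%:E))%E.
  apply: eq_integral => w _; rewrite dotpB expr2 mulr_suml -sumEFin.
  apply: eq_bigr => j _; rewrite mulr_sumr -sumEFin; apply: eq_bigr => k _.
  by rewrite mulrACA EFinM.
rewrite integral_sum//; last first.
  by move=> j; apply: integrable_sum => // k _; exact: integrableZl.
rewrite -sumEFin; apply: eq_bigr => j _.
rewrite integral_sum//; last by move=> k; exact: integrableZl.
rewrite -sumEFin; apply: eq_bigr => k _.
by rewrite integralZl// [RHS]EFinM fineK//; exact: integrable_fin_num.
Qed.

Lemma ae_nonempty (R : realType) d (T : measurableType d) (P : probability T R)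
    (Q : T -> Prop) : {ae P, forall w, Q w} -> exists w, Q w.
Proof.
have PT : (0 < P setT)%E by rewrite probability_setT lte01.
move=> aeQ; exact: (@filter_ex _ _ (ae_properfilter_algebraOfSetsType PT) Q aeQ).
Qed.

Lemma sqrt_div_mul_sqrt (R : realType) (n : nat) (y : R) : (0 < n)%N ->
  Num.sqrt n%:R / n%:R * Num.sqrt y = Num.sqrt (y / n%:R).
Proof.
move=> n0; have nR0 : 0 < n%:R :> R by rewrite ltr0n.
have s0 : 0 < Num.sqrt n%:R :> R by rewrite sqrtr_gt0.
rewrite [in RHS]mulrC sqrtrM ?invr_ge0 ?ler0n// sqrtrV ?ler0n//; congr (_ * _).
have {2}-> : n%:R = Num.sqrt n%:R ^+ 2 :> R by rewrite sqr_sqrtr// ler0n.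
by field; rewrite gt_eqF.
Qed.

Theorem theorem1 (d : measure_display) (T : measurableType d) (R : realType)
    (P : probability T R) (n p : nat) (M sigma K : R) (betastar : p.-tuple R)
    (X : {RV P >-> p.-tuple R}) (eps Y : {RV P >-> R})
    (Z : {RV P >-> (R * p.-tuple R)%type})
    (Zs : 'I_n -> {RV P >-> (R * p.-tuple R)%type})
    (lasso : n.-tuple (R * p.-tuple R) -> p.-tuple R)
    (n_ge1 : (1 <= n)%N) (p_ge1 : (1 <= p)%N)
    (X_bounded : forall j : 'I_p, {ae P, forall w, `|tnth (X w) j| <= M})
    (sigma_ge0 : 0 <= sigma)
    (eps_gaussian : has_law eps (gaussian_law sigma))
    (eps_indep : independent2 P eps X)
    (Y_model : forall w, Y w = dotp betastar (X w) + eps w)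
    (Z_def : forall w, Z w = (Y w, X w))
    (Zs_copies : forall i : 'I_n, identically_distributed (Zs i) Z)
    (Zs_indep : mutually_independent P (fun i : 'I_n => (Zs i : T -> _)))
    (Zs_Z_indep : independent2 P (fun w => [tuple Zs i w | i < n]) Z)
    (K_gt0 : 0 < K)
    (beta_K : norm1 betastar <= K)
    (lassoP : lasso_estimator K lasso) :
  (MSPE P X betastar (fun w => lasso [tuple Zs i w | i < n]) <=
    (2 * K * M * sigma * Num.sqrt (2 * ln (2 * p%:R) / n%:R)
     + 8 * K ^+ 2 * M ^+ 2 * Num.sqrt (2 * ln (2 * p%:R ^+ 2) / n%:R))%:E)%E.
Proof.
case: lassoP => mlasso lassoP.
have j0 : 'I_p := Ordinal p_ge1.
have M0 : 0 <= M.
  by have [w] := ae_nonempty (X_bounded j0); exact: le_trans.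
have nR0 : 0 < n%:R :> R by rewrite ltr0n.
have K0 := ltW K_gt0.
pose data w := [tuple Zs i w | i < n].
have mdata : measurable_fun setT data.
  apply/measurable_fun_tnthP => i.
  rewrite (_ : _ \o _ = Zs i)//; apply/funext => w /=.
  by rewrite tnth_mktuple.
have mb : measurable_fun setT (fun w => lasso (data w)).
  exact: (measurableT_comp mlasso mdata).
have mXj j : measurable_fun setT (fun w => tnth (X w) j).
  exact: (measurableT_comp (measurable_tnth j) (measurable_funPT X)).
have mX2 j k : measurable_fun setT (fun w => tnth (X w) j * tnth (X w) k).
  exact: measurable_funM.
have X2_bounded j k : {ae P, forall w, `|tnth (X w) j * tnth (X w) k| <= M ^+ 2}.
  move: (X_bounded j) (X_bounded k); apply: filterS2 => w Xj Xk.
  by rewrite normrM expr2 ler_pM.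
have intX2 j k := ae_bounded_integrable (mX2 j k) (X2_bounded j k).
pose m j k := fine (\int[P]_w (tnth (X w) j * tnth (X w) k)%:E)%E.
pose noise_score j (z : R * p.-tuple R) := (z.1 - dotp betastar z.2) * tnth z.2 j.
pose gram_gap (a : 'I_p * 'I_p) (z : R * p.-tuple R) :=
  n%:R^-1 * (m a.1 a.2 - tnth z.2 a.1 * tnth z.2 a.2).
have mtnth2 j : measurable_fun setT (fun z : R * p.-tuple R => tnth z.2 j).
  exact: (measurableT_comp (measurable_tnth j) measurable_snd).
have mscore j : measurable_fun setT (noise_score j).
  apply: measurable_funM => //; apply: measurable_funB => //.
  exact: measurable_dotp.
have mgap a : measurable_fun setT (gram_gap a).
  apply: measurable_funM => //; apply: measurable_funB => //.
  exact: measurable_funM.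
(* the noise correlations and the errors in the empirical second moments *)
pose U j w := \sum_(i < n) noise_score j (Zs i w).
pose V a w := \sum_(i < n) gram_gap a (Zs i w).
have mU j : measurable_fun setT (U j).
  by apply: measurable_sum => i; apply: measurableT_comp => //.
have mV a : measurable_fun setT (V a).
  by apply: measurable_sum => i; apply: measurableT_comp => //.
have maxU : (\int[P]_w (\big[Num.max/0]_j `|U j w|)%:E <=
    (Num.sqrt n%:R * (sigma * M) * Num.sqrt (2 * ln (2 * p%:R)))%:E)%E.
  have := @expectation_max_subgaussian _ _ _ P _ U (Num.sqrt n%:R * (sigma * M)).
  rewrite card_ord; apply => //; first by rewrite !mulr_ge0.
  move=> j; apply: iid_sum_mgf Zs_copies Zs_indep (mscore j) _ => u.
  under eq_integral => w _.
    rewrite /noise_score Z_def /= Y_model addrAC subrr add0r.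
    over.
  exact: gaussian_mul_bounded_mgf eps_gaussian eps_indep
    (measurable_tnth j) (X_bounded j).
have maxV : (\int[P]_w (\big[Num.max/0]_a `|V a w|)%:E <=
    (Num.sqrt n%:R * (n%:R^-1 * (2 * M ^+ 2)) *
      Num.sqrt (2 * ln (2 * p%:R ^+ 2)))%:E)%E.
  have := @expectation_max_subgaussian _ _ _ P _ V
    (Num.sqrt n%:R * (n%:R^-1 * (2 * M ^+ 2))).
  rewrite card_prod card_ord natrM -expr2; apply => //.
  - by rewrite muln_gt0 p_ge1.
  - by rewrite !mulr_ge0// ?invr_ge0 ?sqr_ge0// ltW.
  move=> a; apply: iid_sum_mgf Zs_copies Zs_indep (mgap a) _ => u.
  under eq_integral => w _.
    rewrite /gram_gap Z_def /= mulrA.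
    over.
  rewrite exprMn mulrA -exprMn.
  exact: bounded_deviation_mgf (mX2 _ _) (X2_bounded _ _) (sqr_ge0 M).
(* replace the new observation by a copy independent of the data *)
rewrite /MSPE unlock.
pose f (v : n.-tuple (R * p.-tuple R) * (R * p.-tuple R)) : \bar R :=
  ((dotp betastar v.2.2 - dotp (lasso v.1) v.2.2) ^+ 2)%:E.
have mf : measurable_fun setT f.
  apply/measurable_EFinP; apply: measurable_funX; apply: measurable_funB.
    apply: measurable_dotp => //; exact: measurableT_comp.
  apply: measurable_dotp; exact: measurableT_comp.
have f0 v : (0 <= f v)%E by rewrite lee_fin sqr_ge0.
have -> : (\int[P]_w ((dotp betastar (X w) - dotp (lasso (data w)) (X w)) ^+ 2)%:E =
    \int[P]_w f (data w, Z w))%E.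
  by apply: eq_integral => w _; rewrite /f Z_def.
rewrite (independent2_decouple mdata (measurable_funPT Z) Zs_Z_indep mf f0).
pose A := 2 * K / n%:R; pose B := 4 * K ^+ 2.
have A0 : 0 <= A by rewrite /A divr_ge0 ?mulr_ge0// ltW.
have B0 : 0 <= B by rewrite /B mulr_ge0// sqr_ge0.
have mmaxU : measurable_fun setT (fun w => \big[Num.max/0]_j `|U j w|).
  by apply: measurable_bigmaxr => j; exact: measurableT_comp.
have mmaxV : measurable_fun setT (fun w => \big[Num.max/0]_a `|V a w|).
  by apply: measurable_bigmaxr => a; exact: measurableT_comp.
have maxU0 w : 0 <= \big[Num.max/0]_j `|U j w| by exact: bigmax_ge_id.
have maxV0 w : 0 <= \big[Num.max/0]_a `|V a w| by exact: bigmax_ge_id.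
apply: (@le_trans _ _ (\int[P]_w
    (A * (\big[Num.max/0]_j `|U j w|) + B * (\big[Num.max/0]_a `|V a w|))%:E)%E).
  have inner w : (\int[P]_w' f (data w, Z w') =
      (\sum_(j < p) \sum_(k < p) (tnth betastar j - tnth (lasso (data w)) j) *
        (tnth betastar k - tnth (lasso (data w)) k) * m j k)%:E)%E.
    rewrite -(integral_dotp_sqr _ _ intX2).
    by apply: eq_integral => w' _; rewrite /f Z_def.
  apply: ge0_le_integral => //.
  - by move=> w _; apply: integral_ge0.
  - under eq_fun do rewrite inner.
    apply/measurable_EFinP; apply: measurable_sum => j; apply: measurable_sum => k.
    apply: measurable_funM => //; apply: measurable_funM; apply: measurable_funB => //;
      exact: (measurableT_comp (measurable_tnth _) mb).
  - apply/measurable_EFinP; apply: measurable_funD; exact: measurable_funM.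
  - move=> w _; rewrite inner lee_fin.
    apply: (le_trans (lasso_error_bound m n_ge1 (lassoP (data w)) beta_K)).
    rewrite le_eqVlt; apply/orP; left; apply/eqP; congr (_ * _ + _ * _).
      by apply: eq_bigr => j _; congr `|_|; apply: eq_bigr => i _; rewrite tnth_mktuple.
    by apply: eq_bigr => j _; congr `|_|; apply: eq_bigr => i _; rewrite tnth_mktuple.
under eq_integral do
  rewrite EFinD [X in (X + _)%E]EFinM [X in (_ + X)%E]EFinM.
have mmaxUe := (measurable_EFinP _ _).2 mmaxU.
have mmaxVe := (measurable_EFinP _ _).2 mmaxV.
rewrite ge0_integralD//; do ?[exact: measurable_funeM];
  do ?[by move=> w _; rewrite -EFinM lee_fin mulr_ge0].
rewrite !ge0_integralZl//; do ?[by move=> w _; rewrite lee_fin].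
have A0e : (0 <= A%:E)%E by rewrite lee_fin.
have B0e : (0 <= B%:E)%E by rewrite lee_fin.
apply: (le_trans (leeD (lee_wpmul2l A0e maxU) (lee_wpmul2l B0e maxV))).
rewrite -!EFinM -EFinD lee_fin -!sqrt_div_mul_sqrt//.
by rewrite le_eqVlt; apply/orP; left; apply/eqP; rewrite /A /B; field; rewrite gt_eqF.
Qed.
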